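(* Fix $\varepsilon>0$. For the random graph $G_{n,p}$ with edge-probability $p=p(n)$, set $\varphi=\varphi(n,p):=n(1-p)$. (i) If $n^{-o(1)}\le\varphi\ll\log n$, then no interval of length $\lfloor n^{1/2-\varepsilon}\rfloor$ contains $\chi(G_{n,p})$ with high probability. (ii) If $\log n\ll\varphi\le n^{o(1)}$, then there is an interval of length $\lfloor n^{\varepsilon}\rfloor$ that contains $\chi(G_{n,p})$ with high probability.
   Context: $G_{n,p}$ denotes the binomial random graph on vertex set $[n]$ in which each pair of vertices is an edge independently with probability $p$; $\chi$ denotes the chromatic number. For positive functions, $a\ll b$ means $a/b\to0$ as $n\to\infty$; $\varphi\ge n^{-o(1)}$ means $\varphi\ge n^{-\eta(n)}$ for some $\eta(n)\to0$, and $\varphi\le n^{o(1)}$ means $\varphi\le n^{\eta(n)}$ for some $\eta(n)\to 0$. ''With high probability'' means with probability tending to $1$ as $n\to\infty$. ''There is an interval of length $\ell(n)$ that contains $\chi(G_{n,p})$ with high probability'' means there exist intervals $I_n$ of length $\ell(n)$ with $\Pr(\chi(G_{n,p})\in I_n)\to1$; ''no interval of length $\ell(n)$ contains $\chi(G_{n,p})$ with high probability'' means there is no such sequence of intervals. *)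

(* Defs.v *)
From HB Require Import structures.
From mathcomp Require Import all_boot all_order all_algebra.
From mathcomp Require Import all_classical all_reals all_analysis.
Set Implicit Arguments. Unset Strict Implicit. Unset Printing Implicit Defensive.
Import Order.TTheory GRing.Theory Num.Theory.
Import numFieldNormedType.Exports.
Local Open Scope classical_set_scope.
Local Open Scope ring_scope.

(* The vertex set [n] is 'I_n.  The potential edges are the unordered pairs
   {i,j}, i <> j, represented by the ordered pairs (i,j) with i < j. *)
Definition pairs (n : nat) : {set 'I_n * 'I_n} :=
  [set x : 'I_n * 'I_n | (x.1 < x.2)%N].

(* An outcome of G_{n,p}: an edge set E, a subset of [pairs n]. *)
Definition adj (n : nat) (E : {set 'I_n * 'I_n}) (i j : 'I_n) : bool :=
  ((i, j) \in E) || ((j, i) \in E).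

Definition colorable (n : nat) (E : {set 'I_n * 'I_n}) (k : nat) : bool :=
  [exists c : {ffun 'I_n -> 'I_k},
     [forall i : 'I_n, forall j : 'I_n, adj E i j ==> (c i != c j)]].

(* Chromatic number: least k such that E is k-colourable (n colours
   always suffice, so the minimum over k <= n is the chromatic number). *)
Definition chi (n : nat) (E : {set 'I_n * 'I_n}) : nat :=
  \big[minn/n]_(k < n.+1 | colorable E k) k.

(* Probability, in G_{n,p}, of the event {E | P E}: each of the pairs is an
   edge independently with probability p. *)
Definition gnp_prob (R : realType) (n : nat) (p : R)
    (P : {set 'I_n * 'I_n} -> bool) : R :=
  \sum_(E in powerset (pairs n) | P E)
     p ^+ #|E| * (1 - p) ^+ (#|pairs n| - #|E|).

Definition prob_chi_in (R : realType) (n : nat) (p a len : R) : R :=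
  @gnp_prob R n p (fun E => (a <= (chi E)%:R) && ((chi E)%:R <= a + len)).

Definition whp_interval (R : realType) (p ell : nat -> R) : Prop :=
  exists a : nat -> R, (fun n => @prob_chi_in R n (p n) (a n) (ell n)) @ \oo --> (1 : R).

Definition floor_pow (R : realType) (x : R) (n : nat) : R :=
  (Num.floor ((n%:R : R) `^ x))%:~R.

(* Main.v *)
Require Import Defs.
From mathcomp Require Import all_boot all_order all_algebra ring lra zify.
From mathcomp Require Import all_classical all_reals all_analysis.
(* Reimported so that the finite-set names shadow those of classical_sets. *)
From mathcomp Require Import fintype finset.
Set Implicit Arguments. Unset Strict Implicit. Unset Printing Implicit Defensive.
Import Order.TTheory GRing.Theory Num.Theory.
Import numFieldNormedType.Exports.
Local Open Scope set_scope.
Local Open Scope ring_scope.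

(** Write [q = 1 - p] and [phi = n q].

    (i) Clip [chi] to the putative interval [[a, a + l]], extended by one unit
    below, and correlate the clipped value with the number of edges.  Deleting
    the edge [uv] between two universal vertices lowers [chi], so this
    covariance is at least [q] times the expected number of pairs of universal
    vertices on the event that [chi] lies in the interval.  There are about
    [n exp (- phi) = n^(1 - o(1))] universal vertices, whence a lower bound
    [q n^(2 - o(1))].  On the other hand a variable of range [l + 1] has
    covariance at most [(l + 1) n sqrt q] with the number of edges, so
    [l >= n^(1/2 - o(1))].

    (ii) Since [phi >> log n], Hall's theorem gives with high probability a
    perfect matching of non-edges between two halves of the vertex set, so
    [chi <= n - floor (n / 2)].  Conversely a colour class of size [r] contains
    at least [r - 2] independent triples, so [n <= 2 chi + T], where the number
    [T] of independent triples has mean at most [phi^3 = n^o(1)]. *)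

(** * Random subsets *)

Lemma finset_ind (T : finType) (P : {set T} -> Prop) :
  P set0 -> (forall e (D : {set T}), e \notin D -> P D -> P (e |: D)) -> forall D, P D.
Proof.
move=> P0 PU D; have [k cD] : exists k, #|D| = k by exists #|D|.
move: cD.
elim: k D => [D /eqP|k IH D cD]; first by rewrite cards_eq0 => /eqP ->.
have /card_gt0P[e eD] : (0 < #|D|)%N by rewrite cD.
rewrite -(setD1K eD); apply: PU; first by rewrite !inE eqxx.
by apply: IH; move: cD; rewrite (cardsD1 e) eD => -[].
Qed.

Section RandomSubset.
Variables (R : realType) (T : finType) (p : R).
Implicit Types (D E S : {set T}) (f g : {set T} -> R).

Definition Ex D f : R :=
  \sum_(E in powerset D) f E * (p ^+ #|E| * (1 - p) ^+ (#|D| - #|E|)).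

Lemma eq_Ex D f g : (forall E, E \subset D -> f E = g E) -> Ex D f = Ex D g.
Proof. by move=> h; apply: eq_bigr => E; rewrite powersetE => /h ->. Qed.

Lemma ExD D f g : Ex D (fun E => f E + g E) = Ex D f + Ex D g.
Proof. by rewrite /Ex -big_split; apply: eq_bigr => E _; rewrite mulrDl. Qed.

Lemma ExZ D c f : Ex D (fun E => c * f E) = c * Ex D f.
Proof. by rewrite /Ex mulr_sumr; apply: eq_bigr => E _; rewrite -mulrA. Qed.

Lemma ExB D f g : Ex D (fun E => f E - g E) = Ex D f - Ex D g.
Proof.
rewrite /Ex -sumrN -big_split; apply: eq_bigr => E _ /=.
by rewrite mulrBl.
Qed.

Lemma Ex_sum D (I : Type) (r : seq I) (P : pred I) (F : I -> {set T} -> R) :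
  Ex D (fun E => \sum_(i <- r | P i) F i E) = \sum_(i <- r | P i) Ex D (F i).
Proof.
rewrite /Ex exchange_big /=; apply: eq_bigr => E _.
by rewrite mulr_suml.
Qed.

Lemma Ex_setU1 e D f : e \notin D ->
  Ex (e |: D) f = Ex D (fun E => p * f (e |: E) + (1 - p) * f E).
Proof.
move=> eD; rewrite /Ex (bigID (fun E => e \in E)) /= addrC.
have cD : #|e |: D| = #|D|.+1 by rewrite cardsU1 eD.
rewrite (eq_bigl (fun E => E \in powerset D)); last first.
  move=> E; rewrite !powersetE; apply/andP/idP => [[h1 h2]|h].
    apply/subsetP => x xE; have := subsetP h1 x xE.
    by rewrite !inE => /predU1P[xe|//]; rewrite -xe xE in h2.
  split; first exact: subset_trans h (subsetUr _ _).
  by apply: contraNN eD => /(subsetP h).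
rewrite [X in _ + X](reindex_onto (fun E => e |: E) (fun E => E :\ e)) /=; last first.
  by move=> E /andP[_ eE]; rewrite setD1K.
rewrite [X in _ + X](eq_bigl (fun E => E \in powerset D)); last first.
  move=> E; rewrite !powersetE setU11 andbT; apply/andP/idP => [[h1 /eqP h2]|h].
    by rewrite -h2 subDset.
  by rewrite setUS // setU1K //; apply: contraNN eD => /(subsetP h).
rewrite -big_split; apply: eq_bigr => E; rewrite powersetE => /= ED.
have eE : e \notin E by apply: contraNN eD => /(subsetP ED).
have lED : (#|E| <= #|D|)%N by apply: subset_leq_card.
rewrite cD cardsU1 eE add1n subSS subSn // !exprS; ring.
Qed.

Lemma Ex_cst D c : Ex D (fun=> c) = c.
Proof.
elim/finset_ind: D => [|e D eD IH].
  by rewrite /Ex powerset0 big_set1 cards0 !expr0 !mulr1.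
by rewrite Ex_setU1 // -[RHS]IH; apply: eq_Ex => E _; ring.
Qed.

Lemma Ex_split e D f : e \in D ->
  Ex D f = Ex D (fun E => p * f (e |: E) + (1 - p) * f (E :\ e)).
Proof.
move=> eD; rewrite -(setD1K eD); set D' := D :\ e.
have eD' : e \notin D' by rewrite !inE eqxx.
rewrite !Ex_setU1 //; apply: eq_Ex => E ED.
have eE : e \notin E by apply: contraNN eD' => /(subsetP ED).
rewrite setUA setUid setU1K //.
have -> : E :\ e = E by apply/setDidPl; rewrite disjoint_sym disjoints1.
ring.
Qed.

Lemma Ex_subset D S : S \subset D -> Ex D (fun E => (S \subset E)%:R) = p ^+ #|S|.
Proof.
elim/finset_ind: S => [_|e S eS IH].
  rewrite cards0 expr0 -[RHS](Ex_cst D 1); apply: eq_Ex => E _; by rewrite sub0set.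
rewrite subUset sub1set => /andP[eD SD].
rewrite (Ex_split _ eD) cardsU1 eS exprS -IH // -ExZ; apply: eq_Ex => E _.
have -> : (e |: S \subset E :\ e) = false.
  by apply/negbTE/negP => /subsetP /(_ e); rewrite !inE eqxx => /(_ isT).
rewrite mulr0 addr0; congr (_ * _%:R); congr nat_of_bool.
apply/idP/idP => [/subsetP h|h]; last exact: setUS.
apply/subsetP => x xS; have := h x; rewrite !inE xS orbT => /(_ isT) /predU1P[xe|//].
by rewrite -xe xS in eS.
Qed.

Lemma Ex_disjoint D S : S \subset D ->
  Ex D (fun E => (S \subset ~: E)%:R) = (1 - p) ^+ #|S|.
Proof.
elim/finset_ind: S => [_|e S eS IH].
  rewrite cards0 expr0 -[RHS](Ex_cst D 1); apply: eq_Ex => E _; by rewrite sub0set.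
rewrite subUset sub1set => /andP[eD SD].
rewrite (Ex_split _ eD) cardsU1 eS exprS -IH // -ExZ; apply: eq_Ex => E _.
rewrite !subUset !sub1set !inE eqxx /= mulr0 add0r.
congr (_ * _%:R); congr nat_of_bool.
apply/idP/idP => /subsetP h; apply/subsetP => x xS; have := h x xS; rewrite !inE.
  by rewrite negb_and negbK => /orP[/eqP xe|//]; rewrite -xe xS in eS.
by move/negbTE=> ->; rewrite andbF.
Qed.

Lemma Ex_var_card D :
  Ex D (fun E => (#|E|%:R - p * #|D|%:R) ^+ 2) = #|D|%:R * (p * (1 - p)).
Proof.
elim/finset_ind: D => [|e D eD IH].
  by rewrite /Ex powerset0 big_set1 cards0 mulr0 subr0 expr0n !mul0r.
rewrite Ex_setU1 // cardsU1 eD add1n.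
transitivity (Ex D (fun E => (#|E|%:R - p * #|D|%:R) ^+ 2 + p * (1 - p))).
  apply: eq_Ex => E ED.
  have eE : e \notin E by apply: contraNN eD => /(subsetP ED).
  rewrite cardsU1 eE add1n -!natr1; ring.
by rewrite ExD Ex_cst IH -natr1; ring.
Qed.

Hypothesis p01 : 0 <= p <= 1.

Lemma le_Ex D f g : (forall E, E \subset D -> f E <= g E) -> Ex D f <= Ex D g.
Proof.
move=> h; apply: ler_sum => E; rewrite powersetE => /h ?.
by case/andP: p01 => ? ?; rewrite ler_wpM2r // mulr_ge0 ?exprn_ge0 ?subr_ge0.
Qed.

(* The covariance of [W] with the indicator of [e] is [p (1 - p)] times the
   mean effect of toggling [e]. *)
Lemma cov_indicator_ge D e (W : {set T} -> R) (G : pred {set T}) :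
  e \in D ->
  (forall E, E \subset D -> W (E :\ e) + (G (e |: E))%:R <= W (e |: E)) ->
  (1 - p) * Ex D (fun E => ((e \in E) && G E)%:R)
    <= Ex D (fun E => W E * ((e \in E)%:R - p)).
Proof.
move=> eD h; rewrite [leRHS](Ex_split _ eD) (Ex_split _ eD) -ExZ; apply: le_Ex => E ED.
rewrite !inE eqxx /= mulr0n mulr0 addr0.
have := h E ED; set a := W (E :\ e); set b := W (e |: E); set c := _%:R => abc.
have -> : p * (b * (1%:R - p)) + (1 - p) * (a * (0%:R - p)) = (1 - p) * (p * (b - a)).
  by ring.
case/andP: p01 => ? ?.
apply: ler_wpM2l; first lra.
apply: ler_wpM2l; lra.
Qed.

Lemma sum_indicator_card D E : E \subset D -> \sum_(e in D) ((e \in E)%:R : R) = #|E|%:R.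
Proof.
move=> ED; rewrite -natr_sum; congr _%:R.
rewrite (eq_bigr (fun e => if e \in E then 1%N else 0%N)); last by move=> e _; case: (e \in E).
rewrite -big_mkcondr /= sum1dep_card; apply: eq_card => e.
by rewrite inE; apply/andP/idP => [[]//|eE]; split=> //; apply: (subsetP ED).
Qed.
End RandomSubset.

(** * Hall's theorem and chromatic numbers *)

Section Hall.
Variables (A B : finType).
Implicit Types (N : A -> {set B}) (S : {set A}).

Definition nbhd N S : {set B} := \bigcup_(a in S) N a.

Lemma nbhdP N S b : reflect (exists2 a, a \in S & b \in N a) (b \in nbhd N S).
Proof. exact: bigcupP. Qed.

(* Rado's proof: if some [N a] has two elements, one of them can be deleted
   without destroying Hall's condition, by submodularity of [#|nbhd N S|]. *)
Lemma hall N : (forall S, #|S| <= #|nbhd N S|)%N ->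
  exists2 f : A -> B, injective f & forall a, f a \in N a.
Proof.
have [k] : exists k, (\sum_a #|N a| <= k)%N by exists (\sum_a #|N a|)%N.
elim: k N => [|k IH] N Nk HN.
  have N0 a : N a = set0.
    apply/eqP; rewrite -cards_eq0 -leqn0; apply: leq_trans Nk.
    by rewrite (bigD1 a) //= leq_addr.
  have A0 (a : A) : False.
    have := HN [set a]; rewrite cards1 card_gt0 => /set0Pn[b /nbhdP[a' _]].
    by rewrite N0 inE.
  by exists (fun a => match A0 a with end) => a; case: (A0 a).
have [/existsP[a aN]|noa] := boolP [exists a, 1 < #|N a|]%N; last first.
  have Na a : (#|N a| <= 1)%N.
    by rewrite leqNgt; apply: contra noa => h; apply/existsP; exists a.
  have ex a : exists b, b \in N a.
    have := HN [set a]; rewrite cards1 card_gt0 => /set0Pn[b /nbhdP[a']].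
    by rewrite inE => /eqP-> ?; exists b.
  exists (fun a => xchoose (ex a)) => [a a' eqf|a]; last exact: (xchooseP (ex a)).
  apply/eqP/negP => /negP naa'.
  have := HN [set a; a']; rewrite cards2 naa' /=; apply/negP; rewrite -leqNgt.
  rewrite -(cards1 (xchoose (ex a))); apply/subset_leq_card/subsetP => b.
  have fa := xchooseP (ex a); have fa' := xchooseP (ex a').
  case/nbhdP=> c; rewrite !inE => /orP[]/eqP -> bc; apply/eqP.
    by apply: (card_le1_eqP (Na a)).
  by rewrite eqf; apply: (card_le1_eqP (Na a')).
have /card_gt1P[x [y [xN yN xy]]] := aN.
pose N' z := fun c => if c == a then N a :\ z else N c.
have N'sum z : z \in N a -> (\sum_c #|N' z c| <= k)%N.
  move=> zN; move: Nk; rewrite (bigD1 a) //= (cardsD1 z) zN add1n addSn ltnS.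
  apply: leq_trans; rewrite (bigD1 a) //= /N' eqxx leq_add2l.
  by apply: leq_sum => c /negbTE ->.
have N'sub z f : (forall c, f c \in N' z c) -> forall c, f c \in N c.
  by move=> h c; have := h c; rewrite /N'; case: eqP => // ->; rewrite inE => /andP[].
have [okx|/existsP[S nS]] := altP (@forallP _ (fun S => #|S| <= #|nbhd (N' x) S|)%N).
  by have [f fi fN] := IH _ (N'sum _ xN) okx; exists f => //; apply: N'sub fN.
have [oky|/existsP[T nT]] := altP (@forallP _ (fun S => #|S| <= #|nbhd (N' y) S|)%N).
  by have [f fi fN] := IH _ (N'sum _ yN) oky; exists f => //; apply: N'sub fN.
exfalso.
have mem z S0 : ~~ (#|S0| <= #|nbhd (N' z) S0|)%N -> a \in S0.
  apply: contraNT => aS0; have -> // : nbhd (N' z) S0 = nbhd N S0.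
  apply: eq_bigr => c cS; rewrite /N' ifN //.
  by apply: contraNneq aS0 => <-.
have aS := mem _ _ nS; have aT := mem _ _ nT.
have U : nbhd N (S :|: T) \subset nbhd (N' x) S :|: nbhd (N' y) T.
  apply/subsetP => b /nbhdP[c cST bc]; rewrite inE.
  have [eca|nca] := eqVneq c a.
    move: bc; rewrite eca => bc.
    have [ebx|nbx] := eqVneq b x.
      apply/orP; right; apply/nbhdP; exists a => //.
      by rewrite /N' eqxx !inE bc ebx xy.
    by apply/orP; left; apply/nbhdP; exists a; rewrite // /N' eqxx !inE bc nbx.
  move: cST; rewrite inE => /orP[] h; apply/orP; [left|right]; apply/nbhdP;
    by exists c; rewrite // /N' (negbTE nca).
have I : nbhd N ((S :&: T) :\ a) \subset nbhd (N' x) S :&: nbhd (N' y) T.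
  apply/subsetP => b /nbhdP[c]; rewrite !inE => /andP[nca /andP[cS cT]] bc.
  by apply/andP; split; apply/nbhdP; exists c; rewrite // /N' (negbTE nca).
have := leq_add (leq_trans (HN _) (subset_leq_card U)) (leq_trans (HN _) (subset_leq_card I)).
rewrite cardsUI; have := cardsUI S T; have := cardsD1 a (S :&: T).
rewrite inE aS aT /=; move: nS nT; rewrite -!ltnNge; lia.
Qed.
End Hall.

Section Chromatic.
Variable n : nat.
Implicit Types (E : {set 'I_n * 'I_n}).

Lemma adjC E i j : adj E i j = adj E j i.
Proof. by rewrite /adj orbC. Qed.

Lemma colorableP E k : reflect
  (exists c : 'I_n -> 'I_k, forall i j, adj E i j -> c i != c j) (colorable E k).
Proof.
apply: (iffP existsP) => [[c /forallP h]|[c h]].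
  by exists c => i j aij; have /forallP /(_ j) /implyP := h i; apply.
exists [ffun i => c i]; apply/forallP => i; apply/forallP => j.
by rewrite !ffunE; apply/implyP/h.
Qed.

Lemma chi_le_n E : (chi E <= n)%N.
Proof.
rewrite /chi; elim/big_rec: _ => // k x _ h.
by rewrite geq_min h orbT.
Qed.

Lemma chi_min E k : colorable E k -> (chi E <= k)%N.
Proof.
move=> ck; have [kn|nk] := leqP k n; last exact: leq_trans (chi_le_n E) (ltnW nk).
pose j : 'I_n.+1 := Ordinal (kn : k < n.+1)%N.
rewrite /chi; have := mem_index_enum j; elim: (index_enum _) => // i r IH.
rewrite inE big_cons => /predU1P[<-|/IH h]; first by rewrite ck geq_minl.
by case: ifP => _ //; rewrite geq_min h orbT.
Qed.

Lemma colorable_chi E : E \subset pairs n -> colorable E (chi E).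
Proof.
move=> En; rewrite /chi; elim/big_ind: _ => //.
  apply/colorableP; exists id => i j; apply: contraTneq => ->.
  rewrite /adj orbb; apply/negP => /(subsetP En).
  by rewrite inE /= ltnn.
by move=> k l ck cl; rewrite /minn; case: ifP.
Qed.

Lemma chi_mono E E' : E \subset E' -> E' \subset pairs n -> (chi E <= chi E')%N.
Proof.
move=> EE' En; apply: chi_min; have /colorableP[c h] := colorable_chi En.
apply/colorableP; exists c => i j aij; apply: h.
by move: aij; rewrite /adj => /orP[] /(subsetP EE') ->; rewrite ?orbT.
Qed.

Definition star (u : 'I_n) : {set 'I_n * 'I_n} :=
  [set x in pairs n | (x.1 == u) || (x.2 == u)].

Lemma star_sub u : star u \subset pairs n.
Proof. by apply/subsetP => x; rewrite inE => /andP[]. Qed.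

Lemma star_adj E u w : star u \subset E -> w != u -> adj E u w.
Proof.
move=> /subsetP h wu; rewrite /adj.
case: (ltngtP u w) => [uw|wu'|/val_inj e]; last by rewrite e eqxx in wu.
  by rewrite h // !inE /= uw eqxx.
by rewrite [X in _ || X]h ?orbT // !inE /= wu' eqxx orbT.
Qed.

Lemma card_star u : #|star u| = n.-1.
Proof.
pose f (w : 'I_n) := if (w < u)%N then (w, u) else (u, w).
have -> : star u = f @: [set~ u].
  apply/setP => -[i j]; rewrite !inE /=; apply/andP/imsetP.
    case=> ij /orP[] /eqP e; move: ij; rewrite e => ij.
      exists j; first by rewrite !inE; apply: contraTneq ij => ->; rewrite ltnn.
      by rewrite /f ltnNge (ltnW ij).
    exists i; first by rewrite !inE; apply: contraTneq ij => ->; rewrite ltnn.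
    by rewrite /f ij.
  case=> w; rewrite !inE => wu; rewrite /f; case: (ltngtP w u) => [h|h|/val_inj e] [-> ->].
  - by rewrite h eqxx orbT.
  - by rewrite h eqxx.
  - by rewrite e eqxx in wu.
rewrite card_imset; first by rewrite cardsC1 card_ord.
move=> w w'; rewrite /f; case: ifP => h1; case: ifP => h2 [] //.
  by move=> ? ?; subst.
by move=> ? ?; subst.
Qed.

Lemma card_starU u v : u != v -> (2 * n.-1 <= #|star u :|: star v|.+1)%N.
Proof.
move=> uv; have := cardsUI (star u) (star v); rewrite !card_star.
suff : (#|star u :&: star v| <= 1)%N by lia.
rewrite -(cards1 (if (u < v)%N then (u, v) else (v, u))).
apply/subset_leq_card/subsetP => -[i j]; rewrite !inE /=.
case/andP => /andP[ij h1] /andP[_ h2].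
case/orP: h1 => /eqP e1; case/orP: h2 => /eqP e2; subst.
- by rewrite eqxx in uv.
- by rewrite ij.
- by rewrite ltnNge (ltnW ij).
- by rewrite eqxx in uv.
Qed.

Lemma chi_drop E (u v : 'I_n) : E \subset pairs n -> (u < v)%N ->
  star u \subset E -> star v \subset E -> (chi (E :\ (u, v)) < chi E)%N.
Proof.
move=> En uv su sv.
have /colorableP[c h] := colorable_chi En.
have cu w : w != u -> c w != c u by move=> wu; rewrite eq_sym; apply/h/star_adj.
have cv w : w != v -> c w != c v by move=> wv; rewrite eq_sym; apply/h/star_adj.
have nuv : u != v by apply: contraTneq uv => ->; rewrite ltnn.
move: c h cu cv; case E1 : (chi E) => [|k] c h cu cv; first by case: (c u).
rewrite ltnS; apply: chi_min.
pose d w := if w == v then c u else c w.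
have dv w : d w != c v.
  by rewrite /d; case: (eqVneq w v) => [_|]; [exact: (cv u nuv) | exact: cv].
have k0 : 'I_k.
  have := dv u; rewrite eq_sym => /unlift_some[j _ _]; exact: j.
pose g w := odflt k0 (unlift (c v) (d w)).
have gd w : lift (c v) (g w) = d w.
  by rewrite /g; have := dv w; rewrite eq_sym => /unlift_some[j -> ->].
apply/colorableP; exists g => i j aij; apply/negP => /eqP gij.
have : d i = d j by rewrite -!gd gij.
have aE : adj E i j.
  by move: aij; rewrite /adj !inE => /orP[] /andP[_ ->]; rewrite ?orbT.
have nvu : (v, u) \notin E.
  by apply/negP => /(subsetP En); rewrite inE /= ltnNge ltnW.
have auv : adj (E :\ (u, v)) u v = false.
  by rewrite /adj !inE eqxx (negbTE nvu) andbF.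
have nij : ~~ (((i == u) && (j == v)) || ((i == v) && (j == u))).
  apply/negP => /orP[] /andP[/eqP ei /eqP ej]; move: aij; rewrite ei ej.
    by rewrite auv.
  by rewrite adjC auv.
have nee : i != j.
  apply: contraTneq aE => ->; rewrite /adj orbb; apply/negP => /(subsetP En).
  by rewrite inE /= ltnn.
rewrite /d; move: nij; case: (eqVneq i v) => [ei|ni]; case: (eqVneq j v) => [ej|nj] /=.
- by rewrite ei ej eqxx in nee.
- rewrite andbF /= => nju /eqP; rewrite eq_sym; apply/negP; apply: cu.
  by move: nju; rewrite ?orbF.
- rewrite andbT orbF => niu /eqP; apply/negP; exact: cu.
- by move=> _ /eqP; apply/negP; apply: h.
Qed.
End Chromatic.

(** * Spread of the chromatic number *)

Lemma gnp_probE (R : realType) n (p : R) P :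
  @gnp_prob R n p P = Ex p (pairs n) (fun E => (P E)%:R).
Proof.
rewrite /gnp_prob /Ex big_mkcondr; apply: eq_bigr => E _.
by case: (P E); rewrite ?mul1r ?mul0r.
Qed.

Lemma sum_sym_pairs (R : realType) n (f : 'I_n -> 'I_n -> R) :
  (forall i j, f i j = f j i) ->
  \sum_i \sum_j f i j = \sum_i f i i + 2 * \sum_(e in pairs n) f e.1 e.2.
Proof.
move=> fC; rewrite pair_big /= (bigID (fun e => e \in pairs n)) /=.
rewrite [X in _ + X](bigID (fun e : 'I_n * 'I_n => e.1 == e.2)) /=.
have -> : \sum_(e : 'I_n * 'I_n | (e \notin pairs n) && (e.1 == e.2)) f e.1 e.2
          = \sum_i f i i.
  rewrite (reindex_onto (fun i : 'I_n => (i, i)) (fun e => e.1)) /=; last first.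
    by move=> [i j] /= /andP[_ /eqP ->].
  by apply: eq_bigl => i; rewrite !inE /= ltnn !eqxx.
have -> : \sum_(e : 'I_n * 'I_n | (e \notin pairs n) && (e.1 != e.2)) f e.1 e.2
          = \sum_(e in pairs n) f e.1 e.2.
  rewrite (reindex_onto (fun e : 'I_n * 'I_n => (e.2, e.1)) (fun e => (e.2, e.1))) /=; last first.
    by move=> [].
  apply: eq_big => [[i j]|[i j] _]; last exact: fC.
  rewrite !inE /= eqxx andbT -leqNgt -(inj_eq val_inj) /=; by case: ltngtP.
ring.
Qed.

Lemma clip_mono (R : realType) (lo hi x y : R) : x <= y ->
  Num.max lo (Num.min x hi) <= Num.max lo (Num.min y hi).
Proof.
by move=> xy; rewrite /Num.max /Num.min; do ?case: ifPn; rewrite -?leNgt; lra.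
Qed.

Lemma clip_step (R : realType) (lo hi x y : R) : x + 1 <= y -> lo + 1 <= y <= hi ->
  Num.max lo (Num.min x hi) + 1 <= Num.max lo (Num.min y hi).
Proof.
move=> xy /andP[? ?]; rewrite /Num.max /Num.min; do ?case: ifPn; rewrite -?leNgt; lra.
Qed.

Lemma clip_range (R : realType) (lo hi x : R) : lo <= hi ->
  lo <= Num.max lo (Num.min x hi) <= hi.
Proof.
move=> ?; rewrite /Num.max /Num.min; apply/andP; split;
  by do ?case: ifPn; rewrite -?leNgt; lra.
Qed.

Section Spread.
Variables (R : realType) (n : nat) (p : R).
Hypothesis p01 : 0 <= p <= 1.
Local Notation D := (pairs n).
Implicit Types (E : {set 'I_n * 'I_n}).

Definition universal E : R := \sum_u (star u \subset E)%:R.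
Definition mean_universal : R := n%:R * p ^+ n.-1.
Local Notation m := mean_universal.

Lemma universal_sqr E : universal E ^+ 2 =
  universal E + 2 * \sum_(e in D) ((star e.1 \subset E) && (star e.2 \subset E))%:R.
Proof.
have -> : universal E ^+ 2 =
    \sum_u \sum_v ((star u \subset E) && (star v \subset E))%:R.
  rewrite expr2 {1}/universal mulr_suml; apply: eq_bigr => u _.
  rewrite /universal mulr_sumr; apply: eq_bigr => v _.
  by rewrite -natrM mulnb.
rewrite (sum_sym_pairs (f := fun u v => ((star u \subset E) && (star v \subset E))%:R)).
  by congr (_ + _); apply: eq_bigr => u _; rewrite andbb.
by move=> i j; rewrite andbC.
Qed.

Lemma Ex_universal : Ex p D universal = m.
Proof.
rewrite Ex_sum (eq_bigr (fun=> p ^+ n.-1)); last first.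
  by move=> u _; rewrite Ex_subset ?star_sub // card_star.
by rewrite sumr_const card_ord /m mulr_natl.
Qed.

Lemma Ex_universal_sqr :
  p * Ex p D (fun E => universal E ^+ 2) <= p * m + m ^+ 2.
Proof.
case/andP: p01 => p0 p1.
have -> : Ex p D (fun E => universal E ^+ 2) =
    \sum_(u < n) \sum_(v < n) p ^+ #|star u :|: star v|.
  transitivity (\sum_(u < n) \sum_(v < n) Ex p D (fun E => (star u :|: star v \subset E)%:R)).
    under [RHS]eq_bigr do rewrite -Ex_sum.
    rewrite -Ex_sum; apply: eq_Ex => E _.
    rewrite expr2 {1}/universal mulr_suml; apply: eq_bigr => u _.
    rewrite /universal mulr_sumr; apply: eq_bigr => v _.
    by rewrite -natrM mulnb subUset.
  by apply: eq_bigr => u _; apply: eq_bigr => v _; rewrite Ex_subset // subUset !star_sub.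
have -> : p * m + m ^+ 2 =
    \sum_(u < n) \sum_(v < n) ((u == v)%:R * (p * p ^+ n.-1) + p ^+ n.-1 ^+ 2).
  under eq_bigr => u _.
    rewrite big_split /= sumr_const card_ord (bigD1 u) //= eqxx mul1r big1 ?addr0; last first.
      by move=> v /negbTE; rewrite eq_sym => ->; rewrite mul0r.
    over.
  rewrite sumr_const card_ord /mean_universal; set x := p ^+ n.-1.
  rewrite -[RHS]mulr_natl -[x ^+ 2 *+ n]mulr_natl; ring.
rewrite mulr_sumr; apply: ler_sum => u _; rewrite mulr_sumr; apply: ler_sum => v _.
have [->|uv] := eqVneq u v.
  by rewrite setUid card_star mul1r lerDl sqr_ge0.
rewrite mul0r add0r -exprS -exprM mulnC.
by apply: ler_wiXn2l => //; apply: card_starU.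
Qed.

Variables (a ell s : R).
Hypothesis ell0 : 0 <= ell.
Hypothesis s0 : 0 < s.
Definition chi_in_itv E := (a <= (chi E)%:R) && ((chi E)%:R <= a + ell).
Definition clip_chi E := Num.max (a - 1) (Num.min (chi E)%:R (a + ell)) - (a - 1).

Lemma cov_clip_chi_ge :
  (1 - p) * Ex p D (fun E => (chi_in_itv E)%:R * (universal E ^+ 2 - universal E) / 2)
  <= Ex p D (fun E => clip_chi E * (#|E|%:R - p * #|D|%:R)).
Proof.
pose G (e : 'I_n * 'I_n) E := chi_in_itv E && ((star e.1 \subset E) && (star e.2 \subset E)).
have -> : Ex p D (fun E => clip_chi E * (#|E|%:R - p * #|D|%:R)) =
    \sum_(e in D) Ex p D (fun E => clip_chi E * ((e \in E)%:R - p)).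
  rewrite -Ex_sum; apply: eq_Ex => E ED.
  rewrite -mulr_sumr sumrB sum_indicator_card // sumr_const.
  by rewrite mulr_natr.
have -> : Ex p D (fun E => (chi_in_itv E)%:R * (universal E ^+ 2 - universal E) / 2) =
    \sum_(e in D) Ex p D (fun E => ((e \in E) && G e E)%:R).
  rewrite -Ex_sum; apply: eq_Ex => E ED.
  rewrite universal_sqr addrAC subrr add0r mulrCA [2 * _]mulrC mulfK // mulr_sumr.
  apply: eq_bigr => e eD; rewrite -natrM mulnb; congr _%:R; congr nat_of_bool.
  rewrite /G; case: (chi_in_itv E) => /=; last by rewrite andbF.
  case: (boolP (star e.1 \subset E)) => [h|_] /=; last by rewrite andbF.
  by rewrite (subsetP h) // !inE eqxx eqE /= andbT; move: eD; rewrite inE.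
rewrite mulr_sumr; apply: ler_sum => e eD; apply: cov_indicator_ge => // E ED.
have EeD : e |: E \subset D by rewrite subUset sub1set eD.
have sE : E :\ e \subset e |: E.
  exact: subset_trans (subD1set _ _) (subsetUr _ _).
rewrite /clip_chi addrAC lerD2r; case: (boolP (G e _)) => [|_]; last first.
  by rewrite addr0; apply: clip_mono; rewrite ler_nat; apply: chi_mono.
case/andP=> /andP[ha hb] /andP[h1 h2]; apply: clip_step; last by rewrite subrK ha.
rewrite natr1 ler_nat.
have -> : E :\ e = (e |: E) :\ (e.1, e.2).
  by case: (e) => u v /=; apply/setP => x; rewrite !inE; case: eqP.
by apply: chi_drop => //; move: eD; rewrite inE.
Qed.

Lemma cov_clip_chi_le :
  Ex p D (fun E => clip_chi E * (#|E|%:R - p * #|D|%:R))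
  <= (ell + 1) * ((s + n%:R ^+ 2 * (1 - p) / s) / 2).
Proof.
case/andP: p01 => p0 p1.
apply: (@le_trans _ _ (Ex p D (fun E =>
   (ell + 1) * (2^-1 * (s + s^-1 * (#|E|%:R - p * #|D|%:R) ^+ 2))))).
  apply: le_Ex => // E _; set z := _ - _.
  have /andP[w0 w1] : 0 <= clip_chi E <= ell + 1.
    have ae : a - 1 <= a + ell by move: ell0; lra.
    have /(_ (chi E)%:R) := clip_range _ ae.
    by rewrite /clip_chi => /andP[? ?]; apply/andP; split; lra.
  have z2 : 0 <= s^-1 * z ^+ 2 by rewrite mulr_ge0 ?sqr_ge0 // invr_ge0 ltW.
  have zle : z <= 2^-1 * (s + s^-1 * z ^+ 2).
    rewrite -subr_ge0.
    have -> : 2^-1 * (s + s^-1 * z ^+ 2) - z = 2^-1 * s^-1 * (s - z) ^+ 2.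
      by field; rewrite gt_eqF.
    apply: mulr_ge0; last exact: sqr_ge0.
    by apply: mulr_ge0; rewrite invr_ge0 ?ler0n // ltW.
  apply: (le_trans (ler_wpM2l w0 zle)); apply: ler_wpM2r => //.
  by move: z2 s0; lra.
have si0 : 0 <= s^-1 by rewrite invr_ge0 ltW.
rewrite ExZ ExZ ExD Ex_cst ExZ Ex_var_card mulrC [leRHS]mulrC ler_wpM2r //; first by move: ell0; lra.
rewrite [leRHS]mulrC ler_wpM2l ?invr_ge0 // lerD2l mulrC ler_wpM2r //.
rewrite mulrA ler_wpM2r ?subr_ge0 //.
rewrite -[leRHS]mulr1 ler_pM // -natrX ler_nat.
by rewrite -[X in (_ <= X ^ 2)%N]card_ord -mulnn -card_prod max_card.
Qed.

Hypothesis p89 : 8 / 9 <= p.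
Hypothesis m16 : 16 <= m.

(* Pointwise [U ^ 2 >= m ^ 2 / 2 - (U - m) ^ 2], so only the variance of the
   number of universal vertices enters. *)
Lemma Ex_universal_pairs_ge : 3 / 4 <= Ex p D (fun E => (chi_in_itv E)%:R) ->
  m ^+ 2 / 16 <= Ex p D (fun E => (chi_in_itv E)%:R * (universal E ^+ 2 - universal E) / 2).
Proof.
move=> hI.
apply: (@le_trans _ _ (Ex p D (fun E =>
   2^-1 * (m ^+ 2 / 2 * (chi_in_itv E)%:R - (universal E ^+ 2 - 2 * m * universal E + m ^+ 2)
            - universal E)))); last first.
  apply: le_Ex => // E _.
  have U0 : 0 <= universal E by apply: sumr_ge0.
  case: (chi_in_itv E) => /=; rewrite ?mulr1n ?mulr0n ?mul1r ?mul0r ?mulr1 ?mulr0.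
    by move: U0 (sqr_ge0 (universal E - m / 2)); rewrite !expr2; lra.
  by move: U0 (sqr_ge0 (universal E - m)); rewrite !expr2; lra.
rewrite ExZ !ExB ExD ExB !ExZ Ex_cst Ex_universal.
move: hI; set P := Ex _ _ _; set Q := Ex _ _ _ => hI.
have hQ : p * Q <= p * m + m ^+ 2 := Ex_universal_sqr.
have m2 : 16 * m <= m ^+ 2 by rewrite expr2 ler_wpM2r //; move: m16; lra.
have p0 : 0 < p by move: p89; lra.
have hQ' : Q <= m + m ^+ 2 + m ^+ 2 / 8.
  have : p * (Q - m - m ^+ 2 - m ^+ 2 / 8) <= 0.
    suff : 0 <= (9 / 8 * p - 1) * m ^+ 2 by move: hQ; lra.
    by rewrite mulr_ge0 ?sqr_ge0 //; move: p89; lra.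
  by rewrite pmulr_rle0 //; lra.
have : 3 / 4 * m ^+ 2 <= P * m ^+ 2 by rewrite ler_wpM2r ?sqr_ge0.
have mE : n%:R * p ^+ n.-1 = m by [].
by move: m2 hQ'; rewrite expr2 ?mE; lra.
Qed.

Lemma chi_spread : 3 / 4 <= prob_chi_in n p a ell ->
  (1 - p) * (m ^+ 2 / 16) <= (ell + 1) * ((s + n%:R ^+ 2 * (1 - p) / s) / 2).
Proof.
rewrite /prob_chi_in gnp_probE => /Ex_universal_pairs_ge h.
apply: le_trans cov_clip_chi_le; apply: le_trans cov_clip_chi_ge.
by rewrite ler_wpM2l // subr_ge0; case/andP: p01.
Qed.
End Spread.

(** * Concentration of the chromatic number *)

Section IndependentTriples.
Variable n : nat.
Implicit Types (E : {set 'I_n * 'I_n}) (t : 'I_n * 'I_n * 'I_n).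

Definition increasing t := (t.1.1 < t.1.2 < t.2)%N.

Definition triangle t : {set 'I_n * 'I_n} :=
  [set (t.1.1, t.1.2); (t.1.1, t.2); (t.1.2, t.2)].

Definition indep3 E := [set t | increasing t && (triangle t \subset ~: E)].

Lemma triangle_sub t : increasing t -> triangle t \subset pairs n.
Proof.
case: t => [[i j] k] /andP[/= ij jk]; rewrite !subUset !sub1set !inE /=.
by rewrite ij jk (ltn_trans ij jk).
Qed.

Lemma card_triangle t : increasing t -> #|triangle t| = 3.
Proof.
case: t => [[i j] k] /andP[/= ij jk]; rewrite /triangle /= -setUA !cardsU1 cards1 !inE.
rewrite !xpair_eqE -!(inj_eq val_inj) /=.
by rewrite (ltn_eqF ij) (ltn_eqF jk) !andbF.
Qed.

(* A vertex with two smaller vertices in its colour class is the top of an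
   independent triple; each class has at most two other vertices. *)
Lemma chi_indep3 E : E \subset pairs n -> (n <= 2 * chi E + #|indep3 E|)%N.
Proof.
move=> En; have /colorableP[c h] := colorable_chi En.
pose B := [set v : 'I_n | [exists i : 'I_n, exists j : 'I_n,
   [&& (i < j)%N, (j < v)%N, c i == c v & c j == c v]]].
have nE (i j : 'I_n) : c i = c j -> (i, j) \notin E.
  by move=> cij; apply/negP => ij; have := h i j; rewrite /adj ij cij eqxx => /(_ isT).
have BT : (#|B| <= #|indep3 E|)%N.
  apply: leq_trans (leq_imset_card snd _); apply/subset_leq_card/subsetP => v.
  rewrite inE => /existsP[i /existsP[j /and4P[ij jv /eqP ci /eqP cj]]].
  apply/imsetP; exists (i, j, v) => //; rewrite inE /increasing /= ij jv /=.
  by rewrite !subUset !sub1set !inE !nE // ci cj.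
have BC : (#|~: B| <= 2 * chi E)%N.
  rewrite -sum1_card (partition_big c predT) //=.
  rewrite mulnC -[X in (_ <= X * 2)%N]card_ord -sum_nat_const.
  apply: leq_sum => x _; rewrite sum1dep_card leqNgt; apply/negP.
  case/card_gt2P=> u [v [w [[]]]]; rewrite !inE.
  have no (i j k : 'I_n) : c i = x -> c j = x -> c k = x -> i != j ->
      (i < k)%N -> (j < k)%N ->
      ~~ [exists i : 'I_n, exists j : 'I_n,
         [&& (i < j)%N, (j < k)%N, c i == c k & c j == c k]] -> False.
    move=> ci cj ck nij ik jk /negP; apply.
    have [ij|ji|/val_inj e] := ltngtP i j; last by rewrite e eqxx in nij.
      by apply/existsP; exists i; apply/existsP; exists j; rewrite ij jk ci cj ck eqxx.
    by apply/existsP; exists j; apply/existsP; exists i; rewrite ji ik ci cj ck eqxx.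
  move=> /andP[Bu /eqP cu] /andP[Bv /eqP cv] /andP[Bw /eqP cw] [uv vw wu].
  have lt (i j : 'I_n) : i != j -> (i <= j)%N -> (i < j)%N.
    by rewrite ltn_neqAle => -> ->.
  have [uv'|vu'] := leqP u v.
    have [vw'|wv'] := leqP v w.
      have vw2 := lt _ _ vw vw'.
      by apply: (no u v w) => //; apply: leq_ltn_trans vw2.
    by apply: (no w u v) => //; apply: lt.
  have [uw'|wu'] := leqP u w.
    have uw2 : (u < w)%N by apply: lt; rewrite // eq_sym.
    by apply: (no u v w) => //; apply: ltn_trans uw2.
  by apply: (no v w u).
by have := cardsC B; rewrite card_ord; move: BT BC; lia.
Qed.

Lemma Ex_indep3 (R : realType) (p : R) : 0 <= p <= 1 ->
  Ex p (pairs n) (fun E => #|indep3 E|%:R) <= (n%:R * (1 - p)) ^+ 3.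
Proof.
move=> /andP[p0 p1].
have -> : Ex p (pairs n) (fun E => #|indep3 E|%:R) =
   \sum_(t | increasing t) (1 - p) ^+ 3.
  transitivity (\sum_(t | increasing t) Ex p (pairs n) (fun E => (triangle t \subset ~: E)%:R)).
    rewrite -Ex_sum; apply: eq_Ex => E _; rewrite -natr_sum; congr _%:R.
    rewrite -sum1_card (eq_bigl (fun t => increasing t && (triangle t \subset ~: E))); last first.
      by move=> t; rewrite inE.
    by rewrite big_mkcondr; apply: eq_bigr => t _; case: (_ \subset _).
  by apply: eq_bigr => t it; rewrite Ex_disjoint ?triangle_sub // card_triangle.
rewrite sumr_const -[leLHS]mulr_natl exprMn ler_wpM2r ?exprn_ge0 ?subr_ge0 //.
rewrite -natrX ler_nat; apply: leq_trans (max_card _) _.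
by rewrite !card_prod !card_ord !expnS expn0 muln1 mulnA.
Qed.
End IndependentTriples.

Lemma exists_subset_card (T : finType) (A : {set T}) k : (k <= #|A|)%N ->
  exists2 B : {set T}, B \subset A & #|B| = k.
Proof.
elim/finset_ind: A k => [|e A eA IH] k.
  by rewrite cards0 leqn0 => /eqP ->; exists set0; rewrite ?cards0 ?sub0set.
case: k => [_|k]; first by exists set0; rewrite ?cards0 ?sub0set.
rewrite cardsU1 eA add1n ltnS => /IH[B BA cB]; exists (e |: B); first exact: setUS.
by rewrite cardsU1 cB (contra (subsetP BA e) eA).
Qed.

Lemma bin_le_exp m k : ('C(m, k) <= m ^ k)%N.
Proof.
elim: k => [|k IH]; first by rewrite bin0.
have := mul_bin_left m k; rewrite expnS => h.
have : (k.+1 * 'C(m, k.+1) <= m * m ^ k)%N by rewrite h leq_mul // leq_subr.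
by apply: leq_trans; rewrite leq_pmull.
Qed.

Section Matching.
Variable n : nat.
Local Notation m := n./2.
Implicit Types (E : {set 'I_n * 'I_n}) (S T : {set 'I_m}).

Lemma half_le : (m <= n)%N. Proof. by lia. Qed.
Lemma half_add_lt (j : 'I_m) : (m + j < n)%N. Proof. by have := ltn_ord j; lia. Qed.

Definition lo (i : 'I_m) : 'I_n := widen_ord half_le i.
Definition hi (j : 'I_m) : 'I_n := Ordinal (half_add_lt j).
Definition block S T : {set 'I_n * 'I_n} := [set (lo x.1, hi x.2) | x in setX S T].

Lemma block_sub S T : block S T \subset pairs n.
Proof.
apply/subsetP => _ /imsetP[[i j] _ ->]; rewrite inE /=.
by have := ltn_ord i; lia.
Qed.

Lemma card_block S T : #|block S T| = (#|S| * #|T|)%N.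
Proof.
rewrite card_imset ?cardsX // => -[i j] [i' j'] [/= ei ej].
by congr (_, _); apply: val_inj => //=; lia.
Qed.

Lemma chi_half_or_block E : E \subset pairs n ->
  (chi E <= n - m)%N \/
  exists S T, (#|S| + #|T|)%N = m.+1 /\ block S T \subset E.
Proof.
move=> En; pose N i := [set j : 'I_m | (lo i, hi j) \notin E].
have [hallN|/existsP[S nS]] := altP (@forallP _ (fun S => #|S| <= #|nbhd N S|)%N); last first.
  right; exists S; move: nS; rewrite -ltnNge => nS.
  have := cardsC (nbhd N S); rewrite card_ord => cC.
  have Sm : (#|S| <= m)%N by rewrite -[X in (_ <= X)%N]card_ord max_card.
  have [|T TN cT] := @exists_subset_card _ (~: nbhd N S) (m.+1 - #|S|)%N; first lia.
  exists T; split; first by rewrite cT; lia.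
  apply/subsetP => x /imsetP[[i j]]; rewrite inE => /andP[/= iS jT] ->.
  have := subsetP TN j jT; rewrite inE; apply: contraNT => nE.
  by apply/nbhdP; exists i; rewrite // inE.
left; have [f fi fN] := hall hallN; apply: chi_min; apply/colorableP.
have lf (i : 'I_m) : (i < n - m)%N by have := ltn_ord i; lia.
have lh (v : 'I_n) : (m <= v)%N -> (v - m < n - m)%N by have := ltn_ord v; lia.
pose c (v : 'I_n) : 'I_(n - m) :=
  match ltnP v m with
  | LtnNotGeq vm => Ordinal (lf (f (Ordinal vm)))
  | GeqNotLtn vm => Ordinal (lh v vm)
  end.
have aux (u v : 'I_n) : (u < v)%N -> (u, v) \in E -> c u != c v.
  move=> uv uvE; rewrite /c; case: (ltnP u m) => um; case: (ltnP v m) => vm.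
  - apply/eqP => -[] /val_inj /fi [] e; by rewrite e ltnn in uv.
  - apply/eqP => -[] e; have := fN (Ordinal um); rewrite inE.
    have -> : lo (Ordinal um) = u by apply: val_inj.
    have -> : hi (f (Ordinal um)) = v by apply: val_inj; rewrite /= e; lia.
    by rewrite uvE.
  - lia.
  - apply/eqP => -[]; lia.
exists c => u v; rewrite /adj => /orP[] h.
  by apply: aux => //; have := subsetP En _ h; rewrite inE.
by rewrite eq_sym; apply: aux => //; have := subsetP En _ h; rewrite inE.
Qed.

Section Bound.
Variables (R : realType) (p : R) (h : nat).
Hypothesis p01 : 0 <= p <= 1.
Hypothesis n0 : (0 < n)%N.
Hypothesis hh : (2 * h <= m.+1)%N.
Hypothesis small : n%:R ^+ 2 * p ^+ h <= 1.

Lemma block_term_le s t : (s + t = m.+1)%N -> (0 < s <= t)%N ->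
  'C(m, s)%:R * ('C(m, t)%:R * p ^+ (s * t)) <= n%:R ^+ 2 * p ^+ h.
Proof.
case/andP: p01 => p0 p1 st /andP[s0 sle].
have -> : 'C(m, t) = 'C(m, s.-1) by rewrite -bin_sub; [congr 'C(_, _); lia | lia].
apply: (@le_trans _ _ ((n%:R ^+ 2 * p ^+ h) ^+ s)); last first.
  by rewrite -[leRHS]expr1 ler_wiXn2l // mulr_ge0 ?exprn_ge0.
rewrite mulrA exprMn -!exprM ler_pM ?exprn_ge0 ?mulr_ge0 //; last first.
  by rewrite ler_wiXn2l // mulnC leq_mul2l; apply/orP; right; lia.
have le_n k : ('C(m, k) <= n ^ k)%N.
  by apply: leq_trans (bin_le_exp _ _) _; case: k => // k; rewrite leq_exp2r // half_le.
rewrite -natrM -natrX ler_nat mul2n -addnn expnD leq_mul //.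
by apply: leq_trans (le_n _) _; rewrite leq_pexp2l //; lia.
Qed.

Lemma sum_blocks_le :
  \sum_(S : {set 'I_m}) \sum_(T : {set 'I_m} | (#|S| + #|T| == m.+1)%N)
     p ^+ #|block S T| <= n%:R ^+ 3 * p ^+ h.
Proof.
case/andP: p01 => p0 p1.
have c0 : 0 <= n%:R ^+ 2 * p ^+ h by rewrite mulr_ge0 ?exprn_ge0.
pose g s := ('C(m, m.+1 - s)%:R * p ^+ (s * (m.+1 - s)) : R).
have Sm (S : {set 'I_m}) : (#|S| < m.+1)%N.
  by rewrite ltnS -[X in (_ <= X)%N]card_ord max_card.
have -> : \sum_(S : {set 'I_m}) \sum_(T : {set 'I_m} | (#|S| + #|T| == m.+1)%N)
     p ^+ #|block S T| = \sum_(s < m.+1) 'C(m, s)%:R * g s.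
  rewrite (partition_big (fun S : {set 'I_m} => inord #|S| : 'I_m.+1) predT) //=.
  apply: eq_bigr => s _.
  rewrite (eq_bigr (fun=> g s)); last first.
    move=> S /eqP es; have cS : #|S| = s by rewrite -es inordK.
    rewrite (eq_big (fun T : {set 'I_m} => T \in [set A : {set 'I_m} | #|A| == (m.+1 - s)%N])
       (fun=> p ^+ (s * (m.+1 - s)))).
    - by rewrite sumr_const card_draws card_ord /g mulr_natl.
    - move=> T; rewrite inE cS; apply/eqP/eqP => [e|->].
        by rewrite -(addKn s #|T|) e.
      by rewrite subnKC // ltnW.
    - move=> T /eqP e; rewrite card_block cS; congr (_ ^+ (_ * _)).
      by rewrite -(addKn #|S| #|T|) e cS.
  rewrite (eq_bigl (fun S : {set 'I_m} => S \in [set A : {set 'I_m} | #|A| == s])).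
    by rewrite sumr_const card_draws card_ord mulr_natl.
  by move=> S; rewrite inE -(inj_eq val_inj) /= inordK.
apply: (@le_trans _ _ (\sum_(s < m.+1) n%:R ^+ 2 * p ^+ h * (0 < s)%:R)).
  apply: ler_sum => -[s sm] _ /=; rewrite /g; case: s sm => [|s] sm.
    by rewrite subn0 (@bin_small m m.+1) // !mulr0n mul0r !mulr0.
  rewrite mulr1; have [le|lt] := leqP s.+1 (m.+1 - s.+1).
    by apply: block_term_le; lia.
  rewrite mulrCA [(s.+1 * _)%N]mulnC; apply: block_term_le; lia.
rewrite -mulr_sumr big_ord_recl /= mulr0n add0r sumr_const card_ord.
have -> : n%:R ^+ 3 * p ^+ h = n%:R ^+ 2 * p ^+ h * n%:R by ring.
rewrite ler_wpM2l // ler_nat.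
exact: half_le.
Qed.

Lemma prob_chi_ge (ell : nat) : (0 < ell)%N ->
  1 - n%:R ^+ 3 * p ^+ h - (n%:R * (1 - p)) ^+ 3 / ell.+1%:R
  <= prob_chi_in n p ((n%:R - ell%:R) / 2) ell%:R.
Proof.
move=> l0; rewrite /prob_chi_in gnp_probE.
pose X E : R := \sum_(S : {set 'I_m}) \sum_(T : {set 'I_m} | (#|S| + #|T| == m.+1)%N)
     (block S T \subset E)%:R.
have XE : Ex p (pairs n) X <= n%:R ^+ 3 * p ^+ h.
  apply: le_trans sum_blocks_le; rewrite Ex_sum; apply: ler_sum => S _.
  rewrite Ex_sum; apply: ler_sum => T _.
  by rewrite Ex_subset ?block_sub.
have TE := Ex_indep3 n p01.
apply: (@le_trans _ _ (Ex p (pairs n) (fun E => 1 - X E - ell.+1%:R^-1 * #|indep3 E|%:R))).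
  rewrite !ExB Ex_cst ExZ lerB // ?lerB //.
  by rewrite [leRHS]mulrC ler_wpM2l // invr_ge0.
apply: le_Ex => // E En.
have X0 : 0 <= X E by apply: sumr_ge0 => S _; apply: sumr_ge0.
have T0 : 0 <= ell.+1%:R^-1 * #|indep3 E|%:R :> R by rewrite mulr_ge0 ?invr_ge0.
case: (boolP (_ && _)) => [_|nin] /=; first by rewrite -addrA -opprD gerBl addr_ge0.
rewrite mulr0n.
have [chile|[S [T [cST bST]]]] := chi_half_or_block En; last first.
  suff : 1 <= X E by move: T0; move: (X E) (ell.+1%:R^-1 * _) => x y; lra.
  rewrite /X (bigD1 S) //= (bigD1 T) ?cST //= bST.
  have A : 0 <= \sum_(T0 : {set 'I_m} | ((#|S| + #|T0| == m.+1)%N && (T0 != T)))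
     ((block S T0 \subset E)%:R : R) by apply: sumr_ge0.
  have B : 0 <= \sum_(S0 : {set 'I_m} | S0 != S)
     \sum_(T0 : {set 'I_m} | (#|S0| + #|T0| == m.+1)%N) ((block S0 T0 \subset E)%:R : R).
    by apply: sumr_ge0 => ? _; apply: sumr_ge0.
  by rewrite -addrA lerDl addr_ge0.
suff : 1 <= ell.+1%:R^-1 * #|indep3 E|%:R :> R.
  by move: X0; move: (X E) (ell.+1%:R^-1 * _) => x y; lra.
rewrite mulrC ler_pdivlMr ?ltr0n // mul1r ler_nat ltnNge; apply: contra nin => il.
have lower : (n <= 2 * chi E + ell)%N by apply: leq_trans (chi_indep3 En) _; rewrite leq_add2l.
have upper : (2 * chi E <= n + ell)%N by lia.
move: lower upper; rewrite -!(ler_nat R) [(2 * chi E + _)%:R]natrD [(n + _)%:R]natrD !natrM => lower upper.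
by apply/andP; split; lra.
Qed.
End Bound.
End Matching.

(** * Asymptotics *)

Section Asymptotics.
Variable R : realType.
Implicit Types (x p eps : R).

Lemma one_sub_ge_expR x : 0 <= x <= 1 / 2 -> expR (- (2 * x)) <= 1 - x.
Proof.
move=> /andP[x0 x1]; rewrite expRN -[leLHS]mul1r ler_pdivrMr ?expR_gt0 //.
apply: (@le_trans _ _ ((1 - x) * (1 + 2 * x))).
  suff : 0 <= x * (1 - 2 * x) by lra.
  by apply: mulr_ge0; lra.
by apply: ler_wpM2l; [lra | exact: expR_ge1Dx].
Qed.

Lemma exp_ln_nat n : (0 < n)%N -> expR (ln (n%:R : R)) = n%:R.
Proof. by move=> n0; rewrite lnK // posrE ltr0n. Qed.

Lemma powR_nat n x : (0 < n)%N -> (n%:R : R) `^ x = expR (x * ln n%:R).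
Proof. by move=> n0; rewrite /powR pnatr_eq0 gtn_eqF. Qed.

Lemma expRN_le_inv x : 0 <= x -> expR (- x) <= (1 + x)^-1.
Proof. by move=> x0; rewrite expRN lef_pV2 ?posrE ?expR_gt0 ?expR_ge1Dx //; lra. Qed.

Lemma near_ln_ge x : \forall n \near \oo%classic, x <= ln (n%:R : R).
Proof.
have := nbhs_infty_gtr (expR x); apply: filterS => n hn.
have n0 : (0 < n%:R :> R) by apply: lt_trans hn; exact: expR_gt0.
by rewrite -ler_expR lnK // ltW.
Qed.

Lemma floor_pow_ge0 x n : 0 <= floor_pow x n.
Proof. by rewrite /floor_pow ler0z floor_ge0 powR_ge0. Qed.

Lemma no_short_interval n p eps a d :
  (0 < n)%N -> 0 <= p <= 1 -> 0 < d -> 9 * d <= 1 / 4 -> 9 * d <= eps ->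
  256 <= ln (n%:R : R) -> 64 <= 9 * d * ln (n%:R : R) ->
  (n%:R : R) `^ (- d) <= n%:R * (1 - p) -> n%:R * (1 - p) <= d * ln n%:R ->
  3 / 4 <= prob_chi_in n p a (floor_pow (2^-1 - eps) n) -> False.
Proof.
move=> n0 p01; set l := ln _; set q := 1 - p => d0 d4 deps l1 l2 phi1 phi2 hP.
have nE : n%:R = expR l by rewrite exp_ln_nat.
have nR : 0 < n%:R :> R by rewrite ltr0n.
have l0 : 0 <= l by lra.
have q0 : 0 <= q by rewrite subr_ge0; case/andP: p01.
have q36 : q <= 1 / 36.
  rewrite -(ler_pM2l nR); apply: (le_trans phi2).
  have : l <= n%:R by rewrite nE; have := expR_ge1Dx l; lra.
  have : d * l <= 1 / 36 * l by apply: ler_wpM2r => //; lra.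
  lra.
have pE : p = 1 - q by rewrite /q; lra.
have p89 : 8 / 9 <= p by lra.
have m_ge : expR ((1 - 2 * d) * l) <= mean_universal n p.
  rewrite /mean_universal nE.
  have -> : (1 - 2 * d) * l = l + - (2 * d * l) by ring.
  rewrite expRD ler_wpM2l ?expR_ge0 //.
  apply: (@le_trans _ _ (p ^+ n)); last first.
    by apply: ler_wiXn2l; rewrite ?leq_pred //; case/andP: p01.
  apply: (@le_trans _ _ (expR (- (2 * q)) ^+ n)).
    rewrite -expRM_natl ler_expR.
    have := phi2; set P := n%:R * q => P2.
    have -> : n%:R * - (2 * q) = - 2 * P by rewrite /P; ring.
    lra.
  by apply: lerXn2r; rewrite ?nnegrE ?expR_ge0 //; [lra | rewrite pE; apply: one_sub_ge_expR; lra].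
have m16 : 16 <= mean_universal n p.
  apply: le_trans m_ge; have := expR_ge1Dx ((1 - 2 * d) * l).
  have : 1 / 2 * l <= (1 - 2 * d) * l by apply: ler_wpM2r => //; lra.
  lra.
pose s := Num.sqrt (n%:R * (n%:R * q)).
have nq0 : 0 <= n%:R * (n%:R * q) by rewrite !mulr_ge0.
have s2 : s ^+ 2 = n%:R * (n%:R * q) by rewrite sqr_sqrtr.
have s_ge : expR ((1 - d) * l / 2) <= s.
  rewrite -(@ler_pXn2r _ 2) ?nnegrE ?expR_ge0 ?sqrtr_ge0 // s2 -expRM_natl.
  have -> : 2%:R * ((1 - d) * l / 2) = l + (- d) * l by field.
  by rewrite expRD -nE ler_wpM2l // -powR_nat.
have s0 : 0 < s by apply: lt_le_trans s_ge; exact: expR_gt0.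
have := chi_spread p01 (floor_pow_ge0 _ _) s0 p89 m16 hP.
rewrite -/q.
have -> : n%:R ^+ 2 * q / s = s.
  have -> : n%:R ^+ 2 * q = s ^+ 2 by rewrite s2; ring.
  by rewrite expr2 mulfK // gt_eqF.
have -> : (s + s) / 2 = s by field.
set L := floor_pow _ _; set m := mean_universal n p => hmain.
have L_le : L + 1 <= 2 * expR ((2^-1 - 9 * d) * l).
  have h1 : L <= expR ((2^-1 - 9 * d) * l).
    rewrite /L /floor_pow; apply: le_trans (floor_le _) _.
    rewrite powR_nat // ler_expR ler_wpM2r //; lra.
  have h2 : 1 <= expR ((2^-1 - 9 * d) * l).
    by rewrite -[leLHS]expR0 ler_expR mulr_ge0 //; lra.
  lra.
have key : s * m ^+ 2 <= 16 * n%:R ^+ 2 * (L + 1).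
  rewrite -(ler_pM2l s0).
  have -> : s * (s * m ^+ 2) = n%:R ^+ 2 * 16 * (q * (m ^+ 2 / 16)).
    by rewrite mulrA -expr2 s2; field.
  have -> : s * (16 * n%:R ^+ 2 * (L + 1)) = n%:R ^+ 2 * 16 * ((L + 1) * s) by ring.
  by rewrite ler_wpM2l // mulr_ge0 ?sqr_ge0.
have lo : expR ((1 - d) * l / 2) * expR ((1 - 2 * d) * l) ^+ 2 <= s * m ^+ 2.
  by rewrite ler_pM ?exprn_ge0 ?expR_ge0 // lerXn2r ?nnegrE ?expR_ge0 // (le_trans _ m_ge) ?expR_ge0.
have hi : 16 * n%:R ^+ 2 * (L + 1) <= 32 * (expR l ^+ 2 * expR ((2^-1 - 9 * d) * l)).
  rewrite nE.
  have -> : 32 * (expR l ^+ 2 * expR ((2^-1 - 9 * d) * l)) =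
    16 * expR l ^+ 2 * (2 * expR ((2^-1 - 9 * d) * l)) by ring.
  by rewrite ler_wpM2l // mulr_ge0 ?sqr_ge0.
have := le_trans (le_trans lo key) hi.
rewrite -!expRM_natl -!expRD.
set u := 2%:R * l + (2^-1 - 9 * d) * l.
have -> : (1 - d) * l / 2 + 2%:R * ((1 - 2 * d) * l) = 9 * d * l / 2 + u.
  by rewrite /u; field.
rewrite expRD ler_pM2r ?expR_gt0 //.
have := expR_ge1Dx (9 * d * l / 2).
lra.
Qed.

Lemma prob_chi_in_le1 n p a ell : 0 <= p <= 1 -> prob_chi_in n p a ell <= 1.
Proof.
move=> p01; rewrite /prob_chi_in gnp_probE -[leRHS](Ex_cst p (pairs n)).
by apply: le_Ex => // E _; case: (_ && _).
Qed.

Lemma short_interval n p eps :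
  (1 < n)%N -> 0 <= p <= 1 -> 0 < eps ->
  32 * ln (n%:R : R) <= n%:R * (1 - p) -> n%:R * (1 - p) <= (n%:R : R) `^ (eps / 6) ->
  1 - expR (- ln n%:R) - expR (- (eps / 2 * ln n%:R)) <=
  prob_chi_in n p ((n%:R - floor_pow eps n) / 2) (floor_pow eps n).
Proof.
move=> n1 p01 e0; set l := ln _; set q := 1 - p => phi1 phi2.
have n0 : (0 < n)%N by lia.
have nE : n%:R = expR l by rewrite exp_ln_nat.
have l0 : 0 <= l by apply: ln_ge0; rewrite ler1n.
have q0 : 0 <= q by rewrite subr_ge0; case/andP: p01.
pose x := (n%:R : R) `^ eps.
have xE : x = expR (eps * l) by rewrite /x powR_nat.
have f0 : 0 <= Num.floor x by rewrite floor_ge0 powR_ge0.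
pose ell := `|Num.floor x|%N.
have fE : floor_pow eps n = ell%:R.
  by rewrite /floor_pow -/x -(gez0_abs f0).
have ellx : x <= ell.+1%:R.
  have := floorD1_gt x; rewrite -(gez0_abs f0) -/ell intrD => /ltW.
  by rewrite -natr1.
have ell1 : (0 < ell)%N.
  rewrite absz_gt0 floor_neq0 xE -[X in X <= expR _]expR0 ler_expR.
  by rewrite mulr_ge0 ?orbT // ltW.
pose h := (n./2.+1)./2.
have h8 : (n <= 8 * h)%N by rewrite /h; lia.
have ph : p ^+ h <= expR (- (4 * l)).
  have -> : p = 1 + - q by rewrite /q; ring.
  apply: (@le_trans _ _ (expR (- q) ^+ h)).
    by apply: lerXn2r; rewrite ?nnegrE ?expR_ge0 ?expR_ge1Dx //; case/andP: p01; rewrite /q; lra.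
  rewrite -expRM_natl ler_expR.
  have : n%:R * q <= (8 * h)%:R * q by rewrite ler_wpM2r // ler_nat.
  rewrite natrM; set P := n%:R * q in phi1 *.
  lra.
have n2 k : n%:R ^+ k = expR (k%:R * l) by rewrite expRM_natl nE.
have small : n%:R ^+ 2 * p ^+ h <= 1.
  apply: (@le_trans _ _ (expR (2%:R * l) * expR (- (4 * l)))).
    by rewrite n2 ler_wpM2l ?expR_ge0.
  by rewrite -expRD -[leRHS]expR0 ler_expR; lra.
have hh : (2 * h <= n./2.+1)%N by rewrite /h; lia.
rewrite fE; apply: le_trans (prob_chi_ge p01 n0 hh small ell1).
rewrite -/q; apply: lerB.
  apply: lerB => //; apply: (@le_trans _ _ (expR (3%:R * l) * expR (- (4 * l)))).
    by rewrite n2 ler_wpM2l ?expR_ge0.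
  by rewrite -expRD ler_expR; lra.
rewrite ler_pdivrMr ?ltr0n //.
apply: (@le_trans _ _ (expR (- (eps / 2 * l)) * x)); last by rewrite ler_wpM2l ?expR_ge0.
rewrite xE -expRD.
have -> : - (eps / 2 * l) + eps * l = 3%:R * (eps / 6 * l) by field.
rewrite expRM_natl -powR_nat //; apply: lerXn2r => //; rewrite nnegrE ?powR_ge0 //.
by rewrite mulr_ge0.
Qed.

End Asymptotics.

Local Open Scope classical_set_scope.

Theorem theorem2 (R : realType) (eps : R) (heps : 0 < eps) (p : nat -> R)
  (hp : forall n, 0 <= p n <= 1) :
  let phi := fun n : nat => n%:R * (1 - p n) in
  ((* (i) n^{-o(1)} <= phi << log n *)
   (exists eta : nat -> R, eta @ \oo --> (0 : R) /\
      \forall n \near \oo, (n%:R : R) `^ (- eta n) <= phi n) ->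
   (fun n => phi n / ln (n%:R : R)) @ \oo --> (0 : R) ->
   ~ whp_interval p (floor_pow (2^-1 - eps))) /\
  ((* (ii) log n << phi <= n^{o(1)} *)
   (fun n => phi n / ln (n%:R : R)) @ \oo --> +oo ->
   (exists eta : nat -> R, eta @ \oo --> (0 : R) /\
      \forall n \near \oo, phi n <= (n%:R : R) `^ (eta n)) ->
   whp_interval p (floor_pow eps)).
Proof.
move=> phi; split.
  move=> [eta [eta0 hphi]] hlog [a ha].
  pose e' := Num.min eps (1 / 4); pose d := e' / 9.
  have e'0 : 0 < e' by rewrite lt_min heps; lra.
  have d0 : 0 < d by rewrite /d; lra.
  have e'1 : e' <= eps by rewrite ge_min lexx.
  have e'2 : e' <= 1 / 4 by rewrite ge_min lexx orbT.
  have d9 : 9 * d = e' by rewrite /d; field.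
  have [N _ /(_ N (leqnn N))] : \forall n \near \oo, False; last by [].
  have /cvgrPdist_lt/(_ _ d0) H1 := eta0.
  have /cvgrPdist_lt/(_ _ d0) H2 := hlog.
  have /cvgrPdist_lt/(_ (1 / 4)) H3 := ha.
  have {}H3 := H3 ltac:(lra).
  have H4 := near_ln_ge (256 : R).
  have H5 := near_ln_ge (64 / e').
  have H6 := nbhs_infty_gtr (0 : R).
  near=> n.
  have n0 : (0 < n)%N by rewrite -(ltr0n R); near: n.
  have l256 : 256 <= ln (n%:R : R) by near: n.
  have l64 : 64 / e' <= ln (n%:R : R) by near: n.
  have l0 : 0 < ln (n%:R : R) by lra.
  have hprob : `|1 - prob_chi_in n (p n) (a n) (floor_pow (2^-1 - eps) n)| < 1 / 4 by near: n.
  have heta : `|0 - eta n| < d by near: n.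
  have hl : `|0 - phi n / ln n%:R| < d by near: n.
  have hph : (n%:R : R) `^ (- eta n) <= phi n by near: n.
  apply: (@no_short_interval R n (p n) eps (a n) d) => //.
  - lra.
  - lra.
  - by rewrite d9 mulrC -ler_pdivrMr.
  - apply: le_trans hph; rewrite !powR_nat // ler_expR ler_wpM2r ?ltW //.
    by move: heta; rewrite sub0r normrN ltr_norml => /andP[_]; lra.
  - move: hl; rewrite sub0r normrN ltr_norml => /andP[_] /ltW.
    by rewrite ler_pdivrMr.
  - by move: hprob; rewrite ltr_norml => /andP[_]; lra.
move=> hlog [eta [eta0 hphi]].
exists (fun n => (n%:R - floor_pow eps n) / 2).
apply/cvgrPdist_lt => e e0.
have e6 : 0 < eps / 6 by lra.
pose c := Num.min 1 (eps / 2).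
have c0 : 0 < c by rewrite lt_min; apply/andP; split; lra.
have c1 : c <= 1 by rewrite ge_min lexx.
have c2 : c <= eps / 2 by rewrite ge_min lexx orbT.
have /cvgrPdist_lt/(_ _ e6) H1 := eta0.
have /cvgryPge/(_ 32) H2 := hlog.
have H4 := near_ln_ge (2 / e / c).
have H5 := near_ln_ge (1 : R).
have H6 := nbhs_infty_gtr (1 : R).
near=> n.
have n1 : (1 < n)%N by rewrite -(ltr_nat R); near: n.
have l1 : 1 <= ln (n%:R : R) by near: n.
have lc : 2 / e / c <= ln (n%:R : R) by near: n.
have heta : `|0 - eta n| < eps / 6 by near: n.
have hl : 32 <= phi n / ln n%:R by near: n.
have hph : phi n <= (n%:R : R) `^ (eta n) by near: n.
have le1 := @prob_chi_in_le1 R n (p n) ((n%:R - floor_pow eps n) / 2) (floor_pow eps n) (hp n).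
rewrite ger0_norm ?subr_ge0 //.
have := @short_interval R n (p n) eps n1 (hp n) heps.
have -> : 32 * ln n%:R <= n%:R * (1 - p n) by rewrite -ler_pdivlMr //; lra.
have -> : n%:R * (1 - p n) <= n%:R `^ (eps / 6).
  apply: (le_trans hph); rewrite !powR_nat ?(ltnW n1) // ler_expR ler_wpM2r //; first lra.
  by move: heta; rewrite sub0r normrN ltr_norml => /andP[_]; lra.
move=> /(_ isT isT).
set P := prob_chi_in _ _ _ _; set l := ln _ in l1 lc *.
have cl : 2 / e <= c * l by rewrite [leRHS]mulrC -ler_pdivrMr.
have ecl : expR (- (c * l)) < e / 2.
  have cl0 : 0 <= c * l by rewrite mulr_ge0 //; lra.
  apply: le_lt_trans (expRN_le_inv cl0) _.
  rewrite -[ltRHS]invrK invf_div ltf_pV2 ?posrE //; last by rewrite divr_gt0.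
  lra.
  lra.
have h1 : expR (- l) <= expR (- (c * l)).
  rewrite ler_expR lerN2 -[leRHS]mul1r ler_wpM2r //; lra.
have h2 : expR (- (eps / 2 * l)) <= expR (- (c * l)).
  rewrite ler_expR lerN2 ler_wpM2r //; lra.
lra.
Unshelve. all: by end_near.
Qed.
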